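(* Let $k$ be a positive integer, $X$ a finite set, and $\sigma\in\mathrm{SIM}(X)$ with disjoint path and cycle decomposition $\sigma=\sigma_1\sigma_2\cdots\sigma_n$. Then $\alpha\in\mathrm{SIM}(X)$ is a $k$th root of $\sigma$ if and only if $\alpha$ is a product of distinct, disjoint $k$-interlacings of groups of the paths and/or cycles $\sigma_1,\dots,\sigma_n$, excluding none of them; that is, if and only if there is a set partition $\{P_1,\dots,P_m\}$ of $\{\sigma_1,\dots,\sigma_n\}$ such that $\alpha=\alpha_1\cdots\alpha_m$ where each $\alpha_j$ is a $k$-interlacing of the paths/cycles in $P_j$.
   Context: For a finite set $X$, $\mathrm{SIM}(X)$ is the symmetric inverse monoid: the set of all partial one-to-one maps from $X$ to itself, under composition. For distinct $a_1,\dots,a_\ell$, the path $[a_1a_2\cdots a_\ell]$ is the partial map sending $a_i\mapsto a_{i+1}$ for $i<\ell$ and undefined at $a_\ell$ (so $[a]$ is the nowhere-defined map on $\{a\}$); the cycle $(a_1\cdots a_\ell)$ sends $a_i\mapsto a_{i+1}$ for $i<\ell$ and $a_\ell\mapsto a_1$. Its length is $\ell$ and $a_1,\dots,a_\ell$ are its digits. Paths/cycles are disjoint if their digit sets are disjoint, and a product of disjoint paths/cycles is the partial map on the union of their digits agreeing with each one on its digits. Every element of $\mathrm{SIM}(X)$ is uniquely a product of disjoint paths and cycles whose digit sets partition $X$ (its disjoint path and cycle decomposition, length-one paths and cycles included). A $k$th root of $\sigma$ is $\alpha\in\mathrm{SIM}(X)$ with $\alpha^k=\sigma$. Given disjoint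 paths and/or cycles $\tau_1,\dots,\tau_r$ with union of digit sets $D$, a $k$-interlacing of them is a single path or single cycle $\beta$ whose set of digits is exactly $D$ and such that $\beta^k=\tau_1\tau_2\cdots\tau_r$. *)

(* Defs.v *)
From HB Require Import structures.
From mathcomp Require Import all_boot.

Set Implicit Arguments.
Unset Strict Implicit.
Unset Printing Implicit Defensive.

Local Open Scope group_scope.

(* An element of SIM(D) is encoded as a function T -> option T, [None] meaning
   "undefined", that is undefined outside D, takes its values in D, and is
   one-to-one where it is defined. *)
Definition partial_injb (T : finType) (D : {set T})
    (f : {ffun T -> option T}) : bool :=
  [forall x, forall y, (f x == Some y) ==> (x \in D) && (y \in D)] &&
  [forall x, forall x', forall y,
     (f x == Some y) && (f x' == Some y) ==> (x == x')].

Record SIM (T : finType) (D : {set T}) := MkSIM {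
  sim_fun : {ffun T -> option T};
  sim_funP : partial_injb D sim_fun
}.

Definition sim_app (T : finType) (D : {set T}) (f : SIM D) (x : T) : option T :=
  sim_fun f x.
Coercion sim_app : SIM >-> Funclass.

HB.instance Definition _ (T : finType) (D : {set T}) :=
  [isSub for @sim_fun T D].
HB.instance Definition _ (T : finType) (D : {set T}) :=
  [Finite of SIM D by <:].

Section SIMMonoid.
Variables (T : finType) (D : {set T}).
Implicit Types f g h : SIM D.

Lemma partial_injP (f : {ffun T -> option T}) :
  reflect ((forall x y, f x = Some y -> (x \in D) && (y \in D)) /\
           (forall x x' y, f x = Some y -> f x' = Some y -> x = x'))
          (partial_injb D f).
Proof.
apply: (iffP andP) => [[/forallP fD /forallP fI]|[fD fI]]; split.
- by move=> x y /eqP fxy; apply: (implyP (forallP (fD x) y)).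
- move=> x x' y /eqP fx /eqP fx'; apply/eqP.
  by apply: (implyP (forallP (forallP (fI x) x') y)); rewrite fx fx'.
- apply/forallP => x; apply/forallP => y; apply/implyP => /eqP; exact: fD.
- apply/forallP => x; apply/forallP => x'; apply/forallP => y.
  by apply/implyP => /andP[/eqP fx /eqP fx']; apply/eqP; apply: fI fx fx'.
Qed.

Lemma sim_id_subproof :
  partial_injb D [ffun x => if x \in D then Some x else None].
Proof.
apply/partial_injP; split=> [x y|x x' y]; rewrite !ffunE.
  by case: ifP => // xD [<-]; rewrite xD.
by case: ifP => // _ [->]; case: ifP => // _ [->].
Qed.
Definition sim_id : SIM D := MkSIM sim_id_subproof.

Lemma sim_comp_subproof f g :
  partial_injb D [ffun x => obind (sim_fun f) (sim_fun g x)].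
Proof.
have [/partial_injP[fD fI] /partial_injP[gD gI]] := (sim_funP f, sim_funP g).
apply/partial_injP; split=> [x y|x x' y]; rewrite !ffunE.
  case gx: (sim_fun g x) => [z|] //= /fD /andP[_ ->].
  by have /andP[-> _] := gD _ _ gx.
case gx: (sim_fun g x) => [z|] //= fz; case gx': (sim_fun g x') => [z'|] //= fz'.
by apply: gI gx _; rewrite gx' (fI _ _ _ fz fz').
Qed.
Definition sim_comp f g : SIM D := MkSIM (sim_comp_subproof f g).

Lemma sim_compA : associative sim_comp.
Proof.
move=> f g h; apply: val_inj; apply/ffunP => x; rewrite !ffunE /=.
by case: (sim_fun h x) => [y|] //=; rewrite !ffunE.
Qed.

Lemma sim_comp1f : left_id sim_id sim_comp.
Proof.
move=> f; apply: val_inj; apply/ffunP => x; rewrite !ffunE /=.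
case fx: (sim_fun f x) => [y|] //=; rewrite ffunE.
by have /partial_injP[/(_ _ _ fx) /andP[_ ->]] := sim_funP f.
Qed.

Lemma sim_compf1 : right_id sim_id sim_comp.
Proof.
move=> f; apply: val_inj; apply/ffunP => x; rewrite !ffunE /=.
case: ifP => //= xD; case fx: (sim_fun f x) => [y|] //.
by have /partial_injP[/(_ _ _ fx) /andP[]] := sim_funP f; rewrite xD.
Qed.

HB.instance Definition _ :=
  isMonoid.Build (SIM D) sim_compA sim_comp1f sim_compf1.

End SIMMonoid.

(* A partial one-to-one map together with the set on which it lives, so that
   the path [a] and the cycle (b) are maps on {a} and {b} only, and the path
   [a] differs from the empty map. *)
Definition local_map (T : finType) := {D : {set T} & SIM D}.

Definition localize (T : finType) (D : {set T}) (f : SIM D) : local_map T :=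
  Tagged (@SIM T) f.

Definition digits (T : finType) (t : local_map T) : {set T} := tag t.

Definition local_exp (T : finType) (t : local_map T) (k : nat) : local_map T :=
  localize (tagged t ^+ k).

(* [onth] returns [None] past the end of [a], hence at the last digit and
   outside [a]. *)
Definition is_path (T : finType) (t : local_map T) : Prop :=
  exists a : seq T,
    [/\ a <> [::], uniq a, digits t = [set x in a] &
        forall x, tagged t x = onth a (index x a).+1].

Definition is_cycle (T : finType) (t : local_map T) : Prop :=
  exists a : seq T,
    [/\ a <> [::], uniq a, digits t = [set x in a] &
        forall x, tagged t x = if x \in a then Some (next a x) else None].

Definition is_path_or_cycle (T : finType) (t : local_map T) : Prop :=
  is_path t \/ is_cycle t.

(* [f] is the product of the pairwise disjoint family (F i), i in J. *)
Definition is_disjoint_product (T I : finType) (J : {set I})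
    (F : I -> local_map T) (f : local_map T) : Prop :=
  [/\ {in J &, forall i j, i != j -> [disjoint digits (F i) & digits (F j)]},
      digits f = \bigcup_(i in J) digits (F i) &
      {in J, forall i, {in digits (F i), forall x,
         tagged f x = tagged (F i) x}}].

Definition is_decomposition (T : finType) (X : {set T}) (sigma : SIM X)
    (n : nat) (s : 'I_n -> local_map T) : Prop :=
  (forall i, is_path_or_cycle (s i)) /\
  is_disjoint_product [set: 'I_n] s (localize sigma).

Definition is_interlacing (T : finType) (k : nat) (P : {set local_map T})
    (b : local_map T) : Prop :=
  [/\ is_path_or_cycle b,
      digits b = \bigcup_(t in P) digits t &
      is_disjoint_product P id (local_exp b k)].

(* Main.v *)
Require Import Defs.
From mathcomp Require Import all_boot.

(** Join [x] and [y] when [alpha] sends one to the other. On each connected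
    component of this graph [alpha] is a single path or cycle, as one sees by
    taking a longest directed path in the component. When [alpha ^+ k = sigma]
    every path or cycle of [sigma] lies inside one component of [alpha], so the
    components group the factors of [sigma], and [alpha] restricted to a
    component interlaces the factors it contains. The converse is a pointwise
    computation of [alpha ^+ k]. *)

(** * Pointwise rules, powers and restriction *)

Lemma sim_mem {T : finType} {D : {set T}} (f : SIM D) x y :
  f x = Some y -> (x \in D) && (y \in D).
Proof. by have /partial_injP[fD _] := sim_funP f; apply: fD. Qed.

Lemma sim_inj {T : finType} {D : {set T}} (f : SIM D) x x' y :
  f x = Some y -> f x' = Some y -> x = x'.
Proof. by have /partial_injP[_ fI] := sim_funP f; apply: fI. Qed.

Lemma sim_out {T : finType} {D : {set T}} (f : SIM D) x :
  x \notin D -> f x = None.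
Proof. by case fx: (f x) => [y|] // /negP[]; case/andP: (sim_mem f _ _ fx). Qed.

Lemma sim_eqP {T : finType} {D : {set T}} (f g : SIM D) :
  {in D, forall x, f x = g x} -> f = g.
Proof.
move=> fg; apply: val_inj; apply/ffunP => x; rewrite -/(sim_app f x).
rewrite -/(sim_app g x).
by have [/fg //|xD] := boolP (x \in D); rewrite !sim_out.
Qed.

Lemma sim_expE0 {T : finType} {D : {set T}} (f : SIM D) x :
  (f ^+ 0)%g x = if x \in D then Some x else None.
Proof. by rewrite expg0 /sim_app /= ffunE. Qed.

Lemma sim_expES {T : finType} {D : {set T}} (f : SIM D) k x :
  (f ^+ k.+1)%g x = obind (f ^+ k)%g (f x).
Proof. by rewrite expgSr /sim_app /= ffunE. Qed.

(** The values of [f] lie in [D], so an orbit starting in [D] stays there, and [g] follows it step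
    by step until both are undefined. *)
Lemma sim_exp_agree {T : finType} {D E : {set T}} (f : SIM D) (g : SIM E) k :
  D \subset E -> {in D, forall x, g x = f x} ->
  {in D, forall x, (g ^+ k)%g x = (f ^+ k)%g x}.
Proof.
move=> /subsetP DE gf; elim: k => [|k IHk] x xD.
  by rewrite !sim_expE0 xD DE.
rewrite !sim_expES gf //; case fx: (f x) => [y|] //=.
by apply: IHk; case/andP: (sim_mem f _ _ fx).
Qed.

Lemma sim_restr_subproof {T : finType} {D : {set T}} (f : SIM D)
    (C : {set T}) :
  partial_injb C [ffun x => if x \in C then
    obind (fun y => if y \in C then Some y else None) (f x) else None].
Proof.
apply/partial_injP; split=> [x y|x x' y]; rewrite !ffunE.
  by case: ifP => // xC; case: (f x) => //= z; case: ifP => // zC [<-]; rewrite zC.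
case: ifP => // _; case fx: (f x) => [z|] //=; case: ifP => // _ [zy].
case: ifP => // _; case fx': (f x') => [z'|] //=; case: ifP => // _ [zy'].
by apply: (sim_inj f _ _ y); rewrite ?fx ?fx' ?zy ?zy'.
Qed.

(** Dropping the values that leave [C] gives an element of [SIM C] for every [C]. On a set stable
    under [f], such as a component, nothing is dropped. *)
Definition sim_restr {T : finType} {D : {set T}} (f : SIM D) (C : {set T}) :
  SIM C := MkSIM (sim_restr_subproof f C).

Lemma sim_restrE {T : finType} {D : {set T}} (f : SIM D) (C : {set T}) :
  (forall x y, x \in C -> f x = Some y -> y \in C) ->
  {in C, forall x, sim_restr f C x = f x}.
Proof.
move=> fC x xC; rewrite /sim_app /= ffunE xC -/(sim_app f x).
by case fx: (f x) => [y|] //=; rewrite (fC _ _ xC fx).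
Qed.

(** * The graph of a partial map and its components *)

Definition arc {T : finType} {D : {set T}} (f : SIM D) : rel T :=
  [rel x y | f x == Some y].

Definition linked {T : finType} {D : {set T}} (f : SIM D) : rel T :=
  [rel x y | arc f x y || arc f y x].

(** No arc touches a point outside [D], so the component of such a point is a singleton. *)
Definition component {T : finType} {D : {set T}} (f : SIM D) (x : T) :
    {set T} :=
  [set y | connect (linked f) x y].

Lemma linked_sym {T : finType} {D : {set T}} (f : SIM D) :
  connect_sym (linked f).
Proof. by apply: sym_connect_sym => x y; rewrite /linked /= orbC. Qed.

Lemma arc_connect {T : finType} {D : {set T}} (f : SIM D) x y :
  f x = Some y -> connect (linked f) x y.
Proof. by move=> fxy; apply: connect1; rewrite /linked /arc /= fxy eqxx. Qed.

Lemma arc_path_connect {T : finType} {D : {set T}} (f : SIM D) h t :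
  path (arc f) h t -> {in h :: t &, forall x y, connect (linked f) x y}.
Proof.
move=> pht; have pl : path (linked f) h t.
  by apply: sub_path pht => x y; rewrite /linked /= => ->.
move=> x y /(path_connect pl) hx /(path_connect pl) hy.
by apply: connect_trans hy; rewrite linked_sym.
Qed.

Lemma exp_connect {T : finType} {D : {set T}} (f : SIM D) k x y :
  (f ^+ k)%g x = Some y -> connect (linked f) x y.
Proof.
elim: k x => [|k IHk] x; first by rewrite sim_expE0; case: ifP => // _ [->].
rewrite sim_expES; case fx: (f x) => [z|] //= /IHk.
exact: connect_trans (arc_connect f _ _ fx).
Qed.

Lemma component_sub {T : finType} {D : {set T}} (f : SIM D) x :
  x \in D -> component f x \subset D.
Proof.
move=> xD; apply/subsetP => y; rewrite inE => xy.
suff cl : closed (linked f) (mem D) by rewrite -(closed_connect cl xy).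
by move=> u v /= /orP[] /eqP /sim_mem /andP[-> ->].
Qed.

Lemma component_eq {T : finType} {D : {set T}} (f : SIM D) x y :
  connect (linked f) x y -> component f x = component f y.
Proof.
move=> xy; apply/setP => z; rewrite !inE.
exact: (same_connect (linked_sym f)).
Qed.

Lemma component_stable {T : finType} {D : {set T}} (f : SIM D) x u v :
  u \in component f x -> f u = Some v -> v \in component f x.
Proof.
by rewrite !inE => xu /arc_connect; apply: connect_trans.
Qed.

(** * Paths and cycles against components *)

Lemma path_or_cycle_connect {T : finType} (t : local_map T) :
  is_path_or_cycle t ->
  {in digits t &, forall x y, connect (linked (tagged t)) x y}.
Proof.
case=> -[[|h a] [// _ ua -> tE]] x y; rewrite !inE => xa ya.
  apply: (arc_path_connect _ h a) => //; apply/(pathP h) => i lti /=.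
  by rewrite /arc /= tE index_uniq ?ltnS ?(ltnW lti) //= onthE (nth_map h).
apply: (arc_path_connect _ h a) => //.
(* The closing arc is discarded: the others already join all the digits. *)
have := cycle_next ua; rewrite /= rcons_path => /andP[pa _].
apply: (sub_in_path (P := mem (h :: a))) pa; last by apply/allP.
by move=> u v ua' _ /eqP <-; rewrite /arc /= tE ifT.
Qed.

Lemma path_or_cycle_digits_neq0 {T : finType} (t : local_map T) :
  is_path_or_cycle t -> exists x, x \in digits t.
Proof. by case=> -[[|h a] [// _ _ -> _]]; exists h; rewrite !inE eqxx. Qed.

(** Among the repetition-free directed paths through [x], take one of maximal length. A predecessor
    of [h], or a successor of the last vertex, lying off the path could be added to it. *)
Lemma longest_arc_path {T : finType} {D : {set T}} (f : SIM D) x :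
  exists h t, [/\ uniq (h :: t), path (arc f) h t, x \in h :: t,
    forall z, f z = Some h -> z \in h :: t &
    forall z, f (last h t) = Some z -> z \in h :: t].
Proof.
pose P n := [exists a : n.-tuple T, [&& uniq a, sorted (arc f) a & x \in a]].
have P1 : exists n, P n.
  by exists 1; apply/existsP; exists [tuple x]; rewrite /= inE eqxx.
have leP n : P n -> n <= #|T|.
  case/existsP=> a /and3P[ua _ _].
  by rewrite -(size_tuple a) -(card_uniqP ua) max_card.
case: (ex_maxnP P1 leP) => n /existsP[a /and3P[ua sa xa]] maxn.
have maxa (b : seq T) : uniq b -> sorted (arc f) b -> x \in b -> size b <= size a.
  move=> ub sb xb; rewrite size_tuple; apply: maxn.
  by apply/existsP; exists (in_tuple b); rewrite ub sb.
have {}xa : x \in tval a := xa.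
case: (tval a) ua sa xa maxa => [|h t] // ua sa xa maxa; exists h, t; split=> //.
- move=> z fz; apply: contraT => za; have := maxa (z :: h :: t).
  have zs : sorted (arc f) (z :: h :: t) by rewrite /= {1}/arc /= fz eqxx.
  by rewrite cons_uniq za ua zs inE xa orbT ltnn => /(_ isT isT isT).
- move=> z fz; apply: contraT => za; have := maxa (rcons (h :: t) z).
  have zs : sorted (arc f) (rcons (h :: t) z).
    by rewrite /= rcons_path; apply/andP; split=> //; apply/eqP.
  rewrite rcons_uniq za ua zs mem_rcons in_cons xa orbT size_rcons ltnn.
  by move/(_ isT isT isT).
Qed.

(** The vertices of a longest path are closed under arcs in both directions, by maximality at the
    ends and by [step] and injectivity elsewhere, so they fill the component. The map is a path or a
    cycle according to whether [f] is undefined or defined at the last vertex. *)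
Lemma component_path_or_cycle {T : finType} {D : {set T}} (f : SIM D) x :
  is_path_or_cycle (localize (sim_restr f (component f x))).
Proof.
have [h [t [ua pa xa hP lP]]] := longest_arc_path f x.
have step i : i < size t -> f (nth h (h :: t) i) = Some (nth h t i).
  by move=> lti; apply/eqP; move/(pathP h): pa => /(_ i lti).
have fwd u v : u \in h :: t -> f u = Some v -> v \in h :: t.
  move=> /(nthP h)[i]; rewrite ltnS leq_eqVlt => /orP[/eqP -> <-|lti <-].
    by rewrite nth_last; apply: lP.
  by rewrite step // => -[<-]; rewrite inE mem_nth ?orbT.
have bwd u v : v \in h :: t -> f u = Some v -> u \in h :: t.
  move=> /(nthP h)[[|i] lti <-]; first exact: hP.
  by move/sim_inj/(_ (step i lti)) => ->; rewrite mem_nth // ltnW.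
have compE : component f x = [set y in h :: t].
  apply/setP => y; rewrite !in_set; apply/idP/idP => [xy|ya]; last first.
    exact: (arc_path_connect f h t).
  suff cl : closed (linked f) (mem (h :: t)).
    by rewrite -[_ \in _](closed_connect cl xy).
  move=> u v uv; apply/idP/idP => [ua'|va].
    by case/orP: uv => /eqP; [apply: fwd | apply: bwd].
  by case/orP: uv => /eqP; [apply: bwd | apply: fwd].
have restrE := sim_restrE f _ (component_stable f x).
have restr_out y : y \notin h :: t -> sim_restr f (component f x) y = None.
  by move=> ya; apply: sim_out; rewrite compE inE.
have stepx y : y \in h :: t ->
    sim_restr f (component f x) y =
    if index y (h :: t) < size t then Some (nth h t (index y (h :: t)))
    else f (last h t).
  move=> ya; rewrite restrE ?compE ?inE -?in_cons //.
  have := index_mem y (h :: t); rewrite ya ltnS leq_eqVlt => /orP[/eqP E|lti].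
    by rewrite E ltnn -[y in LHS](nth_index h ya) E nth_last.
  by rewrite lti -(step _ lti) nth_index.
case fl: (f (last h t)) => [z|].
  (* If [z] stood at position [i.+1], injectivity would put the last vertex at position [i], which
     is too early. *)
  have zh : z = h.
    have /(nthP h)[[|i] lti zE] := lP _ fl; first by rewrite -zE.
    have := sim_inj f _ _ _ fl; rewrite -zE => /(_ _ (step i lti))/eqP.
    rewrite (last_nth h) nth_uniq //=; last exact: ltnW.
    by move/eqP=> Ei; move: lti; rewrite /= Ei ltnn.
  right; exists (h :: t); split=> // y.
  case: ifP => [ya|/negbT]; last exact: restr_out.
  (* [next_nth] reads the successor in [t] with default [h], so the last vertex is sent to [h]. *)
  rewrite stepx // next_nth ya fl; case: ltnP => // le.
  by rewrite nth_default // zh.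
left; exists (h :: t); split=> // y.
have [ya|ya] := boolP (y \in h :: t); last first.
  by rewrite restr_out // onthE nth_default // size_map memNindex.
rewrite stepx // fl onthE; case: ltnP => le.
  by rewrite (nth_map h).
by rewrite nth_default // size_map.
Qed.

Theorem theorem1 (T : finType) (X : {set T}) (k : nat) (hk : 0 < k)
    (sigma : SIM X) (n : nat) (s : 'I_n -> local_map T)
    (hs : is_decomposition sigma s) (alpha : SIM X) :
  (alpha ^+ k)%g = sigma <->
  exists (Q : {set {set local_map T}})
         (A : {set local_map T} -> local_map T),
    [/\ partition Q [set s i | i : 'I_n],
        {in Q, forall P, is_interlacing k P (A P)} &
        is_disjoint_product Q A (localize alpha)].
Proof.
case: hs => sPC [sdisj sX sE]; split; last first.
  case=> Q [A [/and3P[/eqP covQ _ _] AI [_ AX AE]]].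
  apply: sim_eqP => x xX.
  have : x \in \bigcup_(P in Q) digits (A P) by rewrite -AX.
  case/bigcupP=> P PQ xP; have [_ AD [_ _ AkE]] := AI P PQ.
  have AsubX : digits (A P) \subset X.
    by rewrite -[X]/(digits (localize alpha)) AX (bigcup_sup P).
  (* At [x], [alpha ^+ k] agrees with the power of [A P], hence with the factor [t] of the block [P]
     that contains [x], hence with [sigma]. *)
  rewrite (sim_exp_agree (tagged (A P)) alpha k AsubX (AE P PQ) x xP).
  move: xP; rewrite AD => /bigcupP[t tP xt].
  have := AkE t tP x xt; rewrite /= => ->.
  have : t \in cover Q by apply/bigcupP; exists P.
  rewrite covQ => /imsetP[i _ ti]; rewrite ti in xt *.
  by rewrite -(sE i _ x xt) ?inE.
move=> akE; set S := [set s i | i : 'I_n].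
(* For a factor [s i] this union is a single component ([hullE]); the union avoids choosing a
   digit. *)
pose hull (t : local_map T) : {set T} := \bigcup_(x in digits t) component alpha x.
pose U (P : {set local_map T}) : {set T} := \bigcup_(t in P) digits t.
have digX i : digits (s i) \subset X.
  by rewrite -[X]/(digits (localize sigma)) sX (bigcup_sup i) ?inE.
have covX x : x \in X -> exists i, x \in digits (s i).
  by rewrite -[X]/(digits (localize sigma)) sX => /bigcupP[i _ xi]; exists i.
have s_inj i j x : x \in digits (s i) -> x \in digits (s j) -> i = j.
  move=> xi xj; apply/eqP; apply: contraT => ij.
  by have /disjointFr/(_ xi) := sdisj i j (in_setT _) (in_setT _) ij; rewrite xj.
have s_conn i : {in digits (s i) &, forall x y, connect (linked alpha) x y}.
  (* An arc of [s i] is an arc of [sigma], that is of [alpha ^+ k], hence a walk of [k] arcs of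
     [alpha]. *)
  move=> x y xi yi; have := path_or_cycle_connect _ (sPC i) x y xi yi.
  apply: connect_sub => u v /orP[] /eqP.
    move=> suv; have /andP[ui _] := sim_mem _ _ _ suv.
    by apply: (exp_connect alpha k); rewrite akE -suv; apply: sE; rewrite ?inE.
  move=> svu; have /andP[vi _] := sim_mem _ _ _ svu; rewrite linked_sym.
  by apply: (exp_connect alpha k); rewrite akE -svu; apply: sE; rewrite ?inE.
have hullE i x : x \in digits (s i) -> hull (s i) = component alpha x.
  move=> xi; apply/setP => y; apply/bigcupP/idP => [[z zi]|xy]; last by exists x.
  by rewrite (component_eq alpha x z) // (s_conn i).
(* Two factors share a block when they lie in the same component of [alpha]. *)
pose Q := preim_partition hull S.
have Qpart : partition Q S := preim_partitionP hull S.
have QE P : P \in Q ->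
    exists2 x, x \in X & P = [set t in S | hull t == component alpha x].
  case/imsetP=> t /imsetP[i _ ->] ->.
  have [x xi] := path_or_cycle_digits_neq0 _ (sPC i).
  exists x; first exact: (subsetP (digX i)).
  by apply/setP => u; rewrite !inE (hullE i x xi) eq_sym.
(* A component inside [X] is covered by the digits of the factors that meet it, and each of these
   lies wholly inside it. *)
have UE P : P \in Q -> exists2 x, x \in X & U P = component alpha x.
  case/QE=> x xX ->; exists x => //; apply/setP => y; apply/bigcupP/idP.
    case=> t; rewrite inE => /andP[/imsetP[i _ ->] /eqP hx] yi.
    by rewrite -hx (hullE i y yi) inE connect0.
  move=> xy; have [i yi] := covX y (subsetP (component_sub alpha x xX) y xy).
  exists (s i) => //; rewrite inE imset_f //= (hullE i y yi).
  by rewrite (component_eq alpha x y) // -[connect _ _ _](in_set (connect _ x)).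
have restrE P : P \in Q -> {in U P, forall x, sim_restr alpha (U P) x = alpha x}.
  by case/UE=> x _ ->; apply: sim_restrE; apply: component_stable.
have UsubX P : P \in Q -> U P \subset X.
  by case/UE=> x xX ->; apply: component_sub.
have QS P t : P \in Q -> t \in P -> exists i, t = s i.
  by case/QE=> x _ ->; rewrite inE => /andP[/imsetP[i _ ->] _]; exists i.
exists Q, (fun P => localize (sim_restr alpha (U P))); split=> //.
- move=> P PQ; split=> //.
    by have [x _ ->] := UE P PQ; apply: component_path_or_cycle.
  split=> // [t t' tP t'P|t tP x xt].
    have [i ->] := QS P t PQ tP; have [j ->] := QS P t' PQ t'P => ij.
    by apply: sdisj; rewrite ?inE //; apply: contraNneq ij => ->.
  have xU : x \in U P by apply/bigcupP; exists t.
  have [i ti] := QS P t PQ tP; rewrite ti in xt *.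
  (* Both sides now are powers at [x]: that of the restriction to [U P] and that of [alpha]. *)
  rewrite -(sE i _ x xt) ?inE //= -akE; symmetry.
  apply: sim_exp_agree xU; first exact: UsubX.
  by move=> y yU; rewrite restrE.
- split=> [P P' PQ P'Q PP'||P PQ x xU]; last by rewrite /= restrE.
    (* A digit common to two blocks lies in a single factor, which then belongs to both, so the
       blocks coincide. *)
    rewrite -setI_eq0; apply: contraNT PP' => /set0Pn[x].
    rewrite inE => /andP[/bigcupP[t tP xt] /bigcupP[t' t'P xt']].
    have [i ti] := QS P t PQ tP; have [j tj] := QS P' t' P'Q t'P.
    rewrite ti in xt tP; rewrite tj -(s_inj i j x) -?tj // in t'P.
    have /and3P[_ /trivIsetP tQ _] := Qpart.
    by apply: contraT => /(tQ P P' PQ P'Q)/disjointFr/(_ tP); rewrite t'P.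
  apply/eqP; rewrite eqEsubset; apply/andP; split; last by apply/bigcupsP.
  apply/subsetP => x /covX[i xi].
  have /and3P[/eqP covQ _ _] := Qpart.
  have : s i \in cover Q by rewrite covQ imset_f.
  case/bigcupP=> P PQ iP; apply/bigcupP; exists P => //.
  by apply/bigcupP; exists (s i).
Qed.
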